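(* Let $n\ge 1$ be an integer, let $\xi_n=\exp(2\pi \mathrm{i}/n)$, and let $E_n(p^{-s})$ ($p$ a rational prime) be the Euler factors of the Dedekind zeta function of the cyclotomic field $\mathbb{Q}(\xi_n)$. Then for every prime $p$ there are positive integers $\ell=\ell(n,p)$ and $m=m(n,p)$, depending on $p$ and $n$, such that $$E_n(p^{-s})=\frac{1}{(1-p^{-\ell s})^m}=\sum_{j=0}^{\infty}\binom{j+m-1}{m-1}\frac{1}{(p^{s})^{\ell j}},\qquad \mathrm{Re}(s)>1 .$$ Moreover, for every $$n\in\{3,4,5,7,8,9,11,12,13,15,16,17,19,20,21,24,25,27,28,32,33,35,36,40,44,45,48,60,84\}$$ the integers $\ell$ and $m$ are given as follows. (i) If $p\nmid n$ and $p\equiv k \bmod n$, then $\ell$ is the smallest positive integer with $k^{\ell}\equiv 1 \bmod n$, and $m=\phi(n)/\ell$. (ii) If $p\mid n$, write $n=r\,p^{t}$ with $t\ge 1$ and $p\nmid r$. Then $\ell$ is the smallest positive integer with $p^{\ell}\equiv 1\bmod r$, and $m=\phi(r)/\ell$ (in particular $\ell=m=1$ if $r=1$).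
   Context: $\phi$ is Euler's totient function. The ring of integers of $\mathbb{Q}(\xi_n)$ is $\mathbb{Z}[\xi_n]$. The Dedekind zeta function is $\zeta_{\mathbb{Q}(\xi_n)}(s)=\sum_{\mathfrak a}\mathrm{norm}(\mathfrak a)^{-s}$ for $\mathrm{Re}(s)>1$, the sum running over all non-zero ideals $\mathfrak a$ of $\mathbb{Z}[\xi_n]$, where $\mathrm{norm}(\mathfrak a)=[\mathbb{Z}[\xi_n]:\mathfrak a]$. Its Euler product is $\zeta_{\mathbb{Q}(\xi_n)}(s)=\prod_p E_n(p^{-s})$ over the rational primes $p$, where the Euler factor at $p$ is $E_n(p^{-s})=\sum_{j\ge 0} b_n(p^j)\,p^{-js}$ and $b_n(k)$ denotes the number of ideals of $\mathbb{Z}[\xi_n]$ of norm $k$. *)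

(* Defs.v *)
(* The complex numbers are [R[i]], over a [realType] [R]. *)
From mathcomp Require Export all_boot all_order all_algebra.
From mathcomp Require Export finmap.
From mathcomp Require Export all_classical all_reals all_analysis.
From mathcomp Require Export complex.

Set Implicit Arguments.
Unset Strict Implicit.
Unset Printing Implicit Defensive.

Import Order.TTheory GRing.Theory Num.Theory.
Import numFieldNormedType.Exports.

Local Open Scope classical_set_scope.
Local Open Scope ring_scope.
Local Open Scope complex_scope.

Definition cexp (R : realType) (z : R[i]) : R[i] :=
  (expR (complex.Re z))%:C * (cos (complex.Im z) +i* sin (complex.Im z)).

(* [npow a s] is a^s, for an integer a > 0. *)
Definition npow (R : realType) (a : nat) (s : R[i]) : R[i] :=
  cexp (s * (ln (a%:R : R))%:C).

(* xi_n = exp (2 pi i / n) *)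
Definition xi (R : realType) (n : nat) : R[i] :=
  cexp (0 +i* (2 * pi / n%:R)).

(* The ring Z[xi_n], as a subset of C. *)
Definition Zxi (R : realType) (n : nat) : set R[i] :=
  [set (map_poly intr q).[xi R n] | q in [set: {poly int}]].
Arguments Zxi : clear implicits.

(* Closure under opposite follows from -1 \in Z[xi_n].  MathComp's
   [idealr_closed] is not usable here: it excludes the unit ideal. *)
Definition is_ideal (R : realType) (n : nat) (I : set R[i]) : Prop :=
  [/\ I `<=` Zxi R n,
      I 0,
      (forall x y, I x -> I y -> I (x + y)) &
      (forall a x, Zxi R n a -> I x -> I (a * x))].

Definition cosets (R : realType) (n : nat) (I : set R[i]) : set (set R[i]) :=
  [set [set x + y | y in I] | x in Zxi R n].

(* norm(I) = [Z[xi_n] : I] = k.  The zero ideal has infinite index, hence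
   no norm in this sense. *)
Definition has_norm (R : realType) (n : nat) (I : set R[i]) (k : nat) : Prop :=
  (cosets n I #= `I_k)%card.

Definition ideals_of_norm (R : realType) (n k : nat) : set (set R[i]) :=
  [set I | is_ideal n I /\ has_norm n I k].
Arguments ideals_of_norm : clear implicits.

(* The number b_n(k) of ideals of norm k.  There are finitely many of them
   for each k, so the default value of [fset_set] on infinite sets
   plays no role. *)
Definition nb_ideals (R : realType) (n k : nat) : nat :=
  #|` fset_set (ideals_of_norm R n k)|%fset.

(* The exponent [^o] gives C its norm topology. *)
Definition euler_term (R : realType) (n p : nat) (s : R[i]) (j : nat) :
    (R[i])^o :=
  (nb_ideals R n (p ^ j))%:R * npow p (- (j%:R * s)).

(* E_n(p^-s), the Euler factor at p of the Dedekind zeta function. *)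
Definition euler_factor (R : realType) (n p : nat) (s : R[i]) : (R[i])^o :=
  limn (series (euler_term n p s)).

Definition binomial_term (R : realType) (p l m : nat) (s : R[i]) (j : nat) :
    (R[i])^o :=
  'C(j + m - 1, m - 1)%:R * (1 / npow p s ^+ (l * j)).

(* l is the smallest positive integer with a^l = 1 mod d.  For d = 1 every
   congruence holds, so l = 1. *)
Definition is_mult_order (a : int) (d l : nat) : Prop :=
  [/\ (0 < l)%N,
      (a ^+ l = 1 %[mod d%:Z])%Z &
      forall l' : nat, (0 < l')%N -> (a ^+ l' = 1 %[mod d%:Z])%Z ->
        (l <= l')%N].

(* The cyclotomic fields Q(xi_n) other than Q of class number one; n = 2 mod 4
   is left out,
   as Q(xi_n) = Q(xi_(n/2)) for such n. *)
Definition class_number_one_list : seq nat :=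
  [:: 3; 4; 5; 7; 8; 9; 11; 12; 13; 15; 16; 17; 19; 20; 21; 24; 25; 27; 28;
      32; 33; 35; 36; 40; 44; 45; 48; 60; 84]%N.

(* Main.v *)
(* Write n = r p^t with p not dividing r, A = Z[xi_n], and let l be the order of
   p modulo r and F the field with p^l elements.  The element pi = p if t = 0,
   pi = 1 - xi_n^r otherwise, has a power divisible by p and divides p, and
   A / pi A = F_p[X] / Phi_r is a product of m = phi(r) / l copies of F: the
   projections send xi_n to representatives of the Frobenius orbits of the
   primitive r-th roots of unity in F.  Raising to the power p^N lifts the
   idempotents of A / pi A to idempotents eps_i modulo pi^N, so that an ideal I
   containing pi^N is determined by the exponents
   e_i = min {k | pi^k eps_i in I}; all exponents occur, and I has index
   p^(l (e_1 + .. + e_m)).  An ideal of index k contains k, so an ideal of index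
   p^j contains a power of pi depending only on j.  Hence
   b_n(p^j) = C(j / l + m - 1, m - 1) if l divides j, and 0 otherwise, and the
   Euler factor is a negative binomial series in p^(-ls). *)
Require Import Defs.
From mathcomp Require Import all_boot all_order all_algebra all_field finmap.
From mathcomp Require Import all_classical all_reals all_analysis complex.
From mathcomp Require Import ring lra zify.

Import Order.TTheory GRing.Theory Num.Theory.
Import numFieldNormedType.Exports.

Set Implicit Arguments.
Unset Strict Implicit.
Unset Printing Implicit Defensive.

Local Open Scope classical_set_scope.
Local Open Scope ring_scope.
Local Open Scope complex_scope.

(** * Negative binomial series *)

Definition negbin (K : pzRingType) (m : nat) (w : K) (j : nat) : K :=
  'C(j + m, m)%:R * w ^+ j.

(** By Pascal's rule and induction on [k], a factor [1 - w] lowers [m] by one, up to a boundary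
    term. *)
Lemma negbin_sumS (K : comPzRingType) (m : nat) (w : K) (k : nat) :
  (1 - w) * \sum_(0 <= j < k) negbin m.+1 w j =
  \sum_(0 <= j < k) negbin m w j - 'C(k + m, m.+1)%:R * w ^+ k.
Proof.
elim: k => [|k IH]; first by rewrite !big_geq // bin_small // mul0r subr0 mulr0.
rewrite !big_nat_recr //= mulrDr IH /negbin addSn addnS binS natrD exprS.
ring.
Qed.

Lemma negbin_sum0 (K : comPzRingType) (w : K) (k : nat) :
  (1 - w) * \sum_(0 <= j < k) negbin 0 w j = 1 - w ^+ k.
Proof.
rewrite big_mkord -opprB mulNr -[RHS]opprB subrX1; congr (- (_ * _)).
by apply: eq_bigr => i _; rewrite /negbin addn0 bin0 mul1r.
Qed.

(** The partial sums are nondecreasing and bounded by [(1 - r) ^- m.+1]: this follows by induction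
    on [m], the boundary term in [negbin_sumS] having the right sign. So the series converges and
    its terms tend to 0. *)
Lemma negbin_cvg0 (R : realType) (m : nat) (r : R) :
  0 <= r < 1 -> negbin m r @ \oo --> 0.
Proof.
move=> /andP[r0 r1]; apply: cvg_series_cvg_0.
have s0 : 0 < 1 - r by rewrite subr_gt0.
have nb0 j k : 0 <= negbin j r k by rewrite mulr_ge0 ?exprn_ge0.
apply: nondecreasing_is_cvgn.
  by apply/nondecreasing_seqP => k; rewrite !seriesEnat /= big_nat_recr //= lerDl.
exists ((1 - r) ^- m.+1) => _ [k _ <-]; rewrite seriesEnat /=.
elim: m k => [|m IH] k.
  rewrite expr1 -(ler_pM2l s0) negbin_sum0 mulfV ?gt_eqF // lerBlDr lerDl.
  exact: exprn_ge0.
rewrite -(ler_pM2l s0) negbin_sumS exprS invfM mulrA mulfV ?gt_eqF // mul1r.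
by rewrite (le_trans _ (IH k)) // lerBlDr lerDl mulr_ge0 ?exprn_ge0.
Qed.

Lemma negbin_cvg0C (R : realType) (m : nat) (w : R[i]) :
  `|w| < 1 -> (negbin m w : nat -> (R[i])^o) @ \oo --> 0.
Proof.
move=> w1; have [r wr] : exists r : R, `|w| = r%:C.
  by eexists; exact: normc_def.
(* A positive complex number has imaginary part 0, so only a real bound [e] has to be met, and the
   real case applies to the norms. *)
apply/cvgr0Pnorm_lt => -[e e'] /=; rewrite ltcE /= => /andP[/eqP-> e0].
have r01 : 0 <= r < 1.
  by move: w1 (normr_ge0 w); rewrite wr ltcR lecR => -> ->.
have /cvgr0Pnorm_lt/(_ e e0) := negbin_cvg0 m r01.
apply: filterS => k; rewrite ger0_norm; last first.
  by rewrite mulr_ge0 ?exprn_ge0 //; case/andP: r01.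
rewrite /negbin normrM normrX wr normr_nat -(rmorph_nat (real_complex R)).
by rewrite -rmorphXn -rmorphM ltcR.
Qed.

Lemma negbin_series (K : numFieldType) (m : nat) (w : K) : w != 1 ->
  (forall i, negbin i w @ \oo --> 0) ->
  series (negbin m w) @ \oo --> (1 - w) ^- m.+1.
Proof.
move=> w1 cvg0; have w0 : 1 - w != 0 by rewrite subr_eq0 eq_sym.
rewrite seriesEnat; elim: m => [|m IH].
  have -> : (fun k => \sum_(0 <= j < k) negbin 0 w j) =
      (fun k => (1 - w)^-1 * (1 - negbin 0 w k)).
    apply: funext => k.
    by rewrite {2}/negbin addn0 bin0 mul1r -negbin_sum0 mulrA mulVf // mul1r.
  rewrite expr1 -[X in _ --> X]mulr1 -[X in _ * X]subr0.
  by apply: cvgMl_tmp; apply: cvgB; [exact: cvg_cst|exact: cvg0].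
have -> : (fun k => \sum_(0 <= j < k) negbin m.+1 w j) =
    (fun k => (1 - w)^-1 * (\sum_(0 <= j < k) negbin m w j -
      'C(k + m, m.+1)%:R * w ^+ k)).
  by apply: funext => k; rewrite -negbin_sumS mulrA mulVf // mul1r.
rewrite exprS invfM -[X in _ * X]subr0.
apply: cvgMl_tmp; apply: (cvgB IH).
(* Pascal's rule writes the boundary term as a difference of two sequences tending to 0. *)
have -> : (fun k => 'C(k + m, m.+1)%:R * w ^+ k) =
    (fun k => negbin m.+1 w k - negbin m w k).
  by apply: funext => k; rewrite /negbin addnS binS natrD mulrDl addrK.
by rewrite -(subrr 0); exact: (cvgB (cvg0 m.+1) (cvg0 m)).
Qed.

Lemma negbin_seriesC (R : realType) (m : nat) (w : R[i]) : `|w| < 1 ->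
  series (negbin m w : nat -> (R[i])^o) @ \oo --> ((1 - w) ^- m.+1 : (R[i])^o).
Proof.
move=> w1; apply: (@negbin_series R[i]); last by move=> i; exact: negbin_cvg0C.
by apply: contraTneq w1 => ->; rewrite normr1 ltxx.
Qed.

Lemma series_gaps (K : numFieldType) (V : normedModType K) (l : nat)
    (u v : nat -> V) (a : V) : (0 < l)%N ->
  (forall j, v (l * j)%N = u j) -> (forall j, ~~ (l %| j)%N -> v j = 0) ->
  series u @ \oo --> a -> series v @ \oo --> a.
Proof.
move=> l0 vu v0 ua.
(* The index is the ceiling of [k / l], which is the number of multiples of [l] below [k]. *)
have sv k : series v k = series u ((k + l.-1) %/ l)%N.
  rewrite !seriesEnat /=; elim: k => [|k IH].
    by rewrite add0n divn_small ?prednK // !big_geq.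
  rewrite big_nat_recr //= IH.
  have -> : ((k.+1 + l.-1) %/ l = (k + l.-1) %/ l + (l %| k))%N.
    rewrite addSnnS prednK // divnDr // divnn l0.
    have [/dvdnP[q ->]|] := boolP (l %| k)%N.
      by rewrite mulnK // divnMDl // divn_small ?prednK // addn0 addn1.
    rewrite /dvdn -lt0n addn0 {3}(divn_eq k l) -addnA divnMDl // => r0.
    have /= rl := ltn_pmod k l0.
    have -> : (k %% l + l.-1 = l + (k %% l).-1)%N by lia.
    rewrite divnDl // divnn l0 [((k %% l).-1 %/ l)%N]divn_small; last by lia.
    by rewrite !addn0.
  have [lk|lk] := boolP (l %| k)%N; last by rewrite v0 // addr0 addn0.
  rewrite addn1 big_nat_recr //=; congr (_ + _).
  rewrite -vu; congr v; case/dvdnP: lk => q ->.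
  by rewrite divnMDl // divn_small ?prednK // addn0 mulnC.
have -> : series v = series u \o (fun k => (k + l.-1) %/ l)%N.
  by apply: funext.
apply: cvg_comp ua; apply/cvgnyPge => M.
near=> k; rewrite leq_divRL //; apply: leq_trans (leq_addr _ _).
by near: k; exact: nbhs_infty_ge.
Unshelve. all: by end_near. Qed.

(** * The complex exponential and the powers p^s *)

Lemma cexpD (R : realType) (x y : R[i]) : cexp (x + y) = cexp x * cexp y.
Proof.
case: x y => [a b] [c d]; rewrite /cexp /= expRD cosD sinD.
by apply/eqP; rewrite eq_complex /=; apply/andP; split; apply/eqP; ring.
Qed.

Lemma cexp0 (R : realType) : cexp (0 : R[i]) = 1.
Proof. by rewrite /cexp /= expR0 cos0 sin0 mul1r. Qed.

Lemma cexpMn (R : realType) (x : R[i]) (k : nat) :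
  cexp (k%:R * x) = cexp x ^+ k.
Proof.
elim: k => [|k IH]; first by rewrite mul0r cexp0.
by rewrite -natr1 mulrDl mul1r cexpD IH exprSr.
Qed.

Lemma normr_cexp (R : realType) (x : R[i]) :
  `|cexp x| = (expR (complex.Re x))%:C.
Proof.
rewrite /cexp normrM normc_def /= expr0n addr0 sqrtr_sqr ger0_norm ?expR_ge0 //.
by rewrite normc_def /= cos2Dsin2 sqrtr1 mulr1.
Qed.

Lemma npowMn (R : realType) (p : nat) (s : R[i]) (k : nat) :
  npow p (- (k%:R * s)) = npow p (- s) ^+ k.
Proof. by rewrite /npow -mulrN -mulrA cexpMn. Qed.

Lemma npowN (R : realType) (p : nat) (s : R[i]) : npow p (- s) = (npow p s)^-1.
Proof.
apply: (@mulIf _ (npow p s)).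
  by rewrite -normr_eq0 normr_cexp (inj_eq (@complexI _)) gt_eqF ?expR_gt0.
rewrite mulVf; first by rewrite -cexpD -mulrDl addNr mul0r cexp0.
by rewrite -normr_eq0 normr_cexp (inj_eq (@complexI _)) gt_eqF ?expR_gt0.
Qed.

Lemma npow_lt1 (R : realType) (p : nat) (s : R[i]) :
  (1 < p)%N -> 0 < complex.Re s -> `|npow p (- s)| < 1.
Proof.
case: s => a b /= p1 s0; rewrite normr_cexp ltcR /= mulr0 subr0 -expR0 ltr_expR.
by rewrite expR0 mulNr oppr_lt0 mulr_gt0 // ln_gt0 ?ltr1n.
Qed.

(** * Ideals of finite index *)

Lemma card_II_finset (T : finType) (S : {set T}) : ([set` S] #= `I_#|S|)%card.
Proof.
have -> : [set` S] = (fun i : 'I_#|S| => enum_val i) @` [set: 'I_#|S|].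
  apply/seteqP; split=> [x xS|_ [i _ <-]]; last exact: enum_valP.
  by exists (enum_rank_in xS x); rewrite ?enum_rankK_in.
have -> : `I_#|S| = (fun i : 'I_#|S| => nat_of_ord i) @` [set: 'I_#|S|].
  by apply/seteqP; split=> [k kS|_ [i _ <-]];
    [exists (Ordinal kS)|exact: ltn_ord].
have vinj : {in [set: 'I_#|S|] &, injective (fun i : 'I_#|S| => nat_of_ord i)}.
  by move=> i j _ _; exact: val_inj.
rewrite (card_eqr (inj_card_eq vinj)); apply: inj_card_eq => i j _ _.
exact: enum_val_inj.
Qed.

Section Subring.
Variables (R : realType) (n : nat).
Local Notation A := (Zxi R n).

Lemma Zxi_int (z : int) : A z%:~R.
Proof. by exists z%:P => //; rewrite map_polyC hornerC. Qed.

Lemma Zxi0 : A 0. Proof. exact: Zxi_int 0. Qed.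
Lemma Zxi1 : A 1. Proof. exact: Zxi_int 1. Qed.

Lemma Zxi_xi : A (xi R n).
Proof. by exists 'X => //; rewrite map_polyX hornerX. Qed.

Lemma ZxiD x y : A x -> A y -> A (x + y).
Proof. by move=> [q _ <-] [r _ <-]; exists (q + r); rewrite // rmorphD hornerD.
  Qed.

Lemma ZxiN x : A x -> A (- x).
Proof. by move=> [q _ <-]; exists (- q); rewrite // rmorphN hornerN. Qed.

Lemma ZxiB x y : A x -> A y -> A (x - y).
Proof. by move=> Ax Ay; apply/ZxiD/ZxiN. Qed.

Lemma ZxiM x y : A x -> A y -> A (x * y).
Proof. by move=> [q _ <-] [r _ <-]; exists (q * r); rewrite // rmorphM hornerM.
  Qed.

Lemma ZxiX x k : A x -> A (x ^+ k).
Proof.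
by move=> Ax; elim: k => [|k IH]; [exact: Zxi1|rewrite exprS; exact: ZxiM].
Qed.

Lemma Zxi_sum (I : Type) (r : seq I) (f : I -> R[i]) :
  (forall i, A (f i)) -> A (\sum_(i <- r) f i).
Proof. by move=> Af; apply: (big_ind A Zxi0 ZxiD). Qed.

(** [f] labels the cosets of [I] in Z[xi_n] by the elements of [T]. An arbitrary finite type is
    allowed so that indices multiply through products of types. *)
Definition has_index (I : set R[i]) (T : finType) := exists f : R[i] -> T,
  (forall t, exists2 x, A x & f x = t) /\
  (forall x y, A x -> A y -> (f x = f y <-> I (x - y))).

Section Ideals.
Variable I : set R[i].
Hypothesis idI : is_ideal n I.

Lemma ideal_sub x : I x -> A x. Proof. by case: idI => h _ _ _; apply: h. Qed.
Lemma ideal0 : I 0. Proof. by case: idI. Qed.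
Lemma idealD x y : I x -> I y -> I (x + y).
Proof. by case: idI => _ _ h _; apply: h. Qed.
Lemma idealM a x : A a -> I x -> I (a * x).
Proof. by case: idI => _ _ _; apply. Qed.
Lemma idealN x : I x -> I (- x).
Proof. by move=> Ix; rewrite -mulN1r; apply: idealM => //; exact: Zxi_int (-1).
  Qed.
Lemma idealB x y : I x -> I y -> I (x - y).
Proof. by move=> Ix Iy; apply/idealD/idealN. Qed.

Lemma coset_eq x y :
  [set x + z | z in I] = [set y + z | z in I] <-> I (x - y).
Proof.
split=> [e|Ixy].
  have : [set x + z | z in I] x by exists 0; [exact: ideal0|rewrite addr0].
  by rewrite e => -[z Iz <-]; rewrite addrAC subrr add0r.
apply/seteqP; split=> _ [z Iz <-].
  by exists (x - y + z); [exact: idealD|ring].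
by exists (z - (x - y)); [exact: idealB|ring].
Qed.

Lemma has_norm_index (T : finType) : has_index I T -> has_norm n I #|T|.
Proof.
move=> [f [fs fI]]; have /choice[rep repP] : forall t, exists x, A x /\ f x = t.
  by move=> t; have [x Ax fx] := fs t; exists x.
pose h t := [set rep t + z | z in I].
have -> : has_norm n I #|T| = (cosets n I #= `I_#|T|)%card :> Prop by [].
have -> : cosets n I = h @` [set: T].
  apply/seteqP; split=> [_ [x Ax <-]|_ [t _ <-]]; last first.
    by exists (rep t) => //; case: (repP t).
  exists (f x) => //; apply/coset_eq; have [? ?] := repP (f x).
  by apply/fI.
have hinj : {in [set: T] &, injective h}.
  move=> s t _ _ /coset_eq st; have [As fs'] := repP s; have [At ft'] := repP t.
  by rewrite -fs' -ft'; apply/fI.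
rewrite (card_eql (inj_card_eq hinj)).
have -> : [set: T] = [set` [set: T]%SET] by apply/seteqP; split=> t;
  rewrite /= inE.
by rewrite -cardsT; exact: card_II_finset.
Qed.

Lemma index_has_norm k : (0 < k)%N -> has_norm n I k -> has_index I 'I_k.
Proof.
case: k => // k _ /pcard_eqP[g].
exists (fun x => inord (g [set x + z | z in I])); split=> [t|x y Ax Ay].
  have : `I_k.+1 t by exact: ltn_ord.
  case/(@surj _ _ _ _ g) => _ [x Ax <-] gx.
  by exists x => //; rewrite gx inord_val.
(* The default value of [inord] is never taken on Z[xi_n]. *)
have lt_g z : A z -> (g [set (z + y)%R | y in I] < k.+1)%N.
  by move=> Az; apply: (@funS _ _ _ _ g); exists z.
split=> [|/coset_eq-> //].
move=> /(congr1 val) /=; rewrite !inordK ?lt_g // => gxy.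
by apply/coset_eq; apply: (@inj _ _ _ g) gxy; rewrite inE; [exists x|exists y].
Qed.

(* Translation by 1 permutes the cosets; compare the sums of representatives. *)
Lemma index_in_ideal (T : finType) : has_index I T -> I #|T|%:R.
Proof.
move=> [f [fs fI]]; have /choice[rep repP] : forall t, exists x, A x /\ f x = t.
  by move=> t; have [x Ax fx] := fs t; exists x.
have Arep t : A (rep t) by case: (repP t).
have frep t : f (rep t) = t by case: (repP t).
have Arep1 t : A (rep t + 1) by apply: ZxiD => //; exact: Zxi1.
pose s t := f (rep t + 1).
have sinj : injective s.
  move=> t u /fI - /(_ (Arep1 t) (Arep1 u)).
  by rewrite opprD addrACA subrr addr0 => /fI; rewrite !frep; apply.
have -> : #|T|%:R = \sum_t (rep t + 1 - rep (s t)).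
  rewrite sumrB big_split /= -(reindex_inj sinj (P := xpredT)) /=.
  by rewrite addrAC subrr add0r sumr_const.
apply: (big_ind I ideal0 idealD) => t _.
by apply/fI; rewrite ?frep.
Qed.

(** Multiplicativity of the index along the inclusions of [J] in [I] in Z[xi_n]: [psi] identifies I
    / J with [F], and [x] is labelled by its class modulo [I] together with the value of [psi] on
    its difference to the chosen representative. *)
Lemma index_step (J : set R[i]) (T : finType) (F : finZmodType)
    (psi : R[i] -> F) : has_index I T ->
  (forall x y, I x -> I y -> psi (x + y) = psi x + psi y) ->
  (forall c, exists2 x, I x & psi x = c) ->
  (forall x, J x <-> I x /\ psi x = 0) ->
  has_index J (T * F)%type.
Proof.
move=> [f [fs fI]] psiD psis JE.
have /choice[rep repP] : forall t, exists x, A x /\ f x = t.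
  by move=> t; have [x Ax fx] := fs t; exists x.
have Arep t : A (rep t) by case: (repP t).
have frep t : f (rep t) = t by case: (repP t).
exists (fun x => (f x, psi (x - rep (f x)))); split=> [[t c]|x y Ax Ay].
  have [z Iz <-] := psis c; have Az := ideal_sub Iz.
  exists (rep t + z); first exact: ZxiD.
  have -> : f (rep t + z) = t.
    by rewrite -[RHS]frep; apply/fI => //;
      [exact: ZxiD|rewrite addrAC subrr add0r].
  by rewrite addrAC subrr add0r.
have Iy : I (y - rep (f y)) by apply/fI; rewrite ?frep.
have e z : x - z = (x - y) + (y - z) by ring.
split=> [[fxy]|/JE[Ixy psi0]].
  have Ixy : I (x - y) by apply/fI.
  by rewrite fxy e psiD // -[RHS]add0r => /addIr psi0; apply/JE.
by have -> : f x = f y by [apply/fI]; rewrite e psiD // psi0 add0r.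
Qed.

End Ideals.
End Subring.

(** * Ideals of p-power index *)

(* [pi] is a uniformizer at each of the [m] primes of Z[xi_n] above p, and the
   [phi i] are the residue maps at these primes. *)
Record residue_system (R : realType) (n p : nat) (pi : R[i]) (F : finFieldType)
    (m : nat) (phi : 'I_m -> R[i] -> F) : Prop := ResidueSystem {
  res_pi : Zxi R n pi;
  res_pi0 : pi != 0;
  res_p : Zxi R n (p%:R / pi);
  res_exp : exists e, Zxi R n (pi ^+ e / p%:R);
  res1 : forall i, phi i 1 = 1;
  resD : forall i x y, Zxi R n x -> Zxi R n y ->
    phi i (x + y) = phi i x + phi i y;
  resM : forall i x y, Zxi R n x -> Zxi R n y ->
    phi i (x * y) = phi i x * phi i y;
  res_surj : forall c : 'I_m -> F,
    exists2 x, Zxi R n x & forall i, phi i x = c i;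
  res_ker : forall x, Zxi R n x ->
    (forall i, phi i x = 0) <-> Zxi R n (x / pi) }.

Section Local.
Variables (R : realType) (n p : nat) (pi : R[i]) (F : finFieldType).
Variables (m : nat) (phi : 'I_m -> R[i] -> F).
Hypotheses (rs : residue_system n p pi phi) (p_gt1 : (1 < p)%N).
Hypothesis pF : p \in [pchar F].
Local Notation A := (Zxi R n).
(** Divisibility by [pi ^+ k] in Z[xi_n], tested on the quotient in C. *)
Local Notation D k x := (A (x / pi ^+ k)).

Let pik k : pi ^+ k != 0. Proof. by rewrite expf_neq0 // (res_pi0 rs). Qed.
Let Api k : A (pi ^+ k). Proof. exact/ZxiX/(res_pi rs). Qed.

Lemma res0 i : phi i 0 = 0.
Proof.
by apply: (addIr (phi i 0)); rewrite -(resD rs) ?addr0 ?add0r //; exact: Zxi0.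
Qed.

Lemma resB i x y : A x -> A y -> phi i (x - y) = phi i x - phi i y.
Proof.
move=> Ax Ay; apply: (addIr (phi i y)).
by rewrite -(resD rs) ?subrK //; exact: ZxiB.
Qed.

Lemma resX i x k : A x -> phi i (x ^+ k) = phi i x ^+ k.
Proof.
move=> Ax; elim: k => [|k IH]; first by rewrite !expr0 (res1 rs).
by rewrite !exprS (resM rs) ?IH //; exact: ZxiX.
Qed.

Lemma res_sum i (I : Type) (r : seq I) (f : I -> R[i]) : (forall k, A (f k)) ->
  phi i (\sum_(k <- r) f k) = \sum_(k <- r) phi i (f k).
Proof.
move=> Af; elim: r => [|k r IH]; first by rewrite !big_nil res0.
by rewrite !big_cons (resD rs) ?IH //; exact: Zxi_sum.
Qed.

Lemma dvd_piD k x y : D k x -> D k y -> D k (x + y).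
Proof. by rewrite mulrDl; exact: ZxiD. Qed.

Lemma dvd_piN k x : D k x -> D k (- x).
Proof. by rewrite mulNr; exact: ZxiN. Qed.

Lemma dvd_piB k x y : D k x -> D k y -> D k (x - y).
Proof. by move=> Dx Dy; apply/dvd_piD/dvd_piN. Qed.

Lemma dvd_piM j k x y : D j x -> D k y -> D (j + k)%N (x * y).
Proof. by rewrite exprD invfM mulrACA; exact: ZxiM. Qed.

Lemma dvd_pi0 x : D 0 x = A x. Proof. by rewrite expr0 divr1. Qed.

Lemma dvd_piMr k x y : D k x -> A y -> D k (x * y).
Proof. by rewrite -(dvd_pi0 y) => Dx Dy; rewrite -(addn0 k); exact: dvd_piM. Qed.

Lemma dvd_piMl k x y : A x -> D k y -> D k (x * y).
Proof. by move=> Ax Dy; rewrite (mulrC x); exact: dvd_piMr. Qed.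

Lemma dvd_pi_le j k x : (j <= k)%N -> D k x -> D j x.
Proof.
move=> jk; rewrite -{1}(subnKC jk) exprD invfM mulrA => Dx.
by rewrite -[_ / _](divfK (pik (k - j))); exact: ZxiM.
Qed.

Lemma dvd_pi_sub k x : D k x -> A x.
Proof. by move/(dvd_pi_le (leq0n k)); rewrite dvd_pi0. Qed.

Lemma dvd_pi_piM k j x : D (k + j)%N (pi ^+ k * x) = D j x.
Proof. by rewrite exprD invfM mulrACA divff // mul1r. Qed.

Lemma dvd_pi_div k x : D 1 (x / pi ^+ k) = D k.+1 x.
Proof. by rewrite expr1 exprSr invfM mulrA. Qed.

Lemma dvd_pi_sum k (I : Type) (r : seq I) (f : I -> R[i]) :
  (forall i, D k (f i)) -> D k (\sum_(i <- r) f i).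
Proof. by move=> Df; rewrite mulr_suml; exact: Zxi_sum. Qed.

Lemma dvd_pi1 x : A x -> (forall i, phi i x = 0) <-> D 1 x.
Proof. by rewrite expr1; exact: res_ker rs x. Qed.

Lemma dvd_pi1_res i x : D 1 x -> phi i x = 0.
Proof. by move=> Dx; apply: (dvd_pi1 (dvd_pi_sub Dx)).2. Qed.

(* [x^p - y^p] is [x - y] times a sum with residues [p * phi(y)^(p-1) = 0]. *)
Lemma pow_congr N x y : A x -> A y -> (forall i, phi i x = phi i y) ->
  D N.+1 (x ^+ (p ^ N) - y ^+ (p ^ N)).
Proof.
move=> Ax Ay xy; elim: N => [|N IH].
  by apply/dvd_pi1; [exact: ZxiB|move=> i; rewrite !expr1 resB // xy subrr].
rewrite expnSr !exprM subrXX -addn1; apply: dvd_piM => //.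
set x' := x ^+ _; set y' := y ^+ _.
have Ax' : A x' by exact: ZxiX.
have Ay' : A y' by exact: ZxiX.
have AM j : A (x' ^+ (p.-1 - j) * y' ^+ j) by apply: ZxiM; exact: ZxiX.
apply/dvd_pi1 => [|i]; first by apply: Zxi_sum => j; exact: AM.
rewrite res_sum //=.
rewrite (eq_bigr (fun=> phi i y' ^+ p.-1)) => [|j _]; last first.
  rewrite (resM rs) ?resX //; try exact: ZxiX.
  rewrite xy -!exprM -exprD; congr (_ ^+ _).
  by rewrite -mulnDr; congr muln; have := ltn_ord j; lia.
by rewrite sumr_const card_ord -mulr_natr (pcharf0 pF) mulr0.
Qed.

(** * Ideals containing a fixed power of [pi] *)

Section Idempotents.
Variable N : nat.

(* Raising to the power [p ^ N] lifts idempotents modulo [pi] to idempotents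
   modulo [pi ^+ N]. *)
Lemma idempotents_exist : exists eps : 'I_m -> R[i],
  [/\ forall i, A (eps i),
      forall i j, phi j (eps i) = (j == i)%:R,
      forall i j, i != j -> D N (eps i * eps j),
      D N (1 - \sum_i eps i) &
      forall i y, A y -> (forall j, phi j y = (j == i)%:R) ->
        D N (eps i - y ^+ (p ^ N))].
Proof.
have /choice[u uP] : forall i, exists u, A u /\ forall j, phi j u = (j == i)%:R.
  move=> i; have [u Au phiu] := res_surj rs (fun j => (j == i)%:R).
  by exists u.
have Au i : A (u i) by case: (uP i).
have phiu i j : phi j (u i) = (j == i)%:R by case: (uP i).
pose eps i := u i ^+ (p ^ N); exists eps.
have Aeps i : A (eps i) by exact: ZxiX.
have pN : (0 < p ^ N)%N by rewrite expn_gt0 ltnW.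
have phieps i j : phi j (eps i) = (j == i)%:R.
  rewrite resX // phiu; case: eqP => _; first by rewrite expr1n.
  by rewrite expr0n eqn0Ngt pN.
have epsM i j : i != j -> D N (eps i * eps j).
  move=> ij; have Auu : A (u i * u j) by exact: ZxiM.
  have := @pow_congr N _ 0 Auu (Zxi0 _ _).
  rewrite expr0n eqn0Ngt pN subr0 exprMn => h; apply: (dvd_pi_le (leqnSn N));
    apply: h.
  move=> k; rewrite res0 (resM rs) // !phiu; case: eqP => [->|];
    last by rewrite mul0r.
  by rewrite (negPf ij) mulr0.
have eps_congr i y : A y -> (forall j, phi j y = (j == i)%:R) ->
    D N (eps i - y ^+ (p ^ N)).
  by move=> Ay phiy; apply: (dvd_pi_le (leqnSn N)); apply: pow_congr => // j;
    rewrite phiu.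
split=> //; set s := \sum_i eps i.
have As : A s by exact: Zxi_sum.
have Ad : A (1 - s) by apply: ZxiB => //; exact: Zxi1.
(* Up to products of distinct [eps], this is [eps i - eps i ^+ 2]; here [eps i ^+ 2] is the
   [p ^ N]-th power of [u i ^+ 2], which has the same residues as [u i]. *)
have epsd i : D N (eps i * (1 - s)).
  rewrite mulrBr mulr1 /s mulr_sumr (bigD1 i) //= opprD addrA; apply: dvd_piB.
    rewrite -expr2 -exprAC; apply: eps_congr; first exact: ZxiX.
    by move=> j; rewrite resX // phiu; case: eqP; rewrite ?expr1n // expr0n.
  rewrite -big_filter mulr_suml big_filter.
  by apply: (big_ind A (Zxi0 _ _) (@ZxiD _ _)) => j ji; apply: epsM;
    rewrite eq_sym.
have dd : D N ((1 - s) - (1 - s) * (1 - s)).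
  have -> : (1 - s) - (1 - s) * (1 - s) = \sum_i (eps i * (1 - s)).
    by rewrite -mulr_suml -/s; ring.
  exact: dvd_pi_sum.
have d1 : D 1 (1 - s).
  apply/dvd_pi1 => // i; rewrite resB //; last exact: Zxi1.
  rewrite (res1 rs) res_sum // (bigD1 i) //= phieps eqxx big1 ?addr0 ?subrr //.
  by move=> j ji; rewrite phieps eq_sym (negPf ji).
(* With d = 1 - s, d is d^2 modulo [pi ^+ N] and [pi] divides d, so each use of this congruence
   gains one factor [pi]. *)
have dk k : (k <= N)%N -> D k (1 - s).
  elim: k => [_|k IH kN]; first by rewrite dvd_pi0.
  rewrite -(subrK ((1 - s) * (1 - s)) (1 - s)); apply: dvd_piD;
    first exact: dvd_pi_le dd.
  by rewrite -add1n; apply: dvd_piM => //; apply/IH/ltnW.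
exact: dk.
Qed.

Variable eps : 'I_m -> R[i].
Hypothesis Aeps : forall i, A (eps i).
Hypothesis phieps : forall i j, phi j (eps i) = (j == i)%:R.
Hypothesis epsM : forall i j, i != j -> D N (eps i * eps j).
Hypothesis eps_sum : D N (1 - \sum_i eps i).
Hypothesis eps_congr : forall i y, A y -> (forall j, phi j y = (j == i)%:R) ->
  D N (eps i - y ^+ (p ^ N)).

(** When all [e i <= N], these are the elements of valuation at least [e i] at the [i]-th prime
    above p; the factor [eps i] removes the conditions at the other primes. *)
Definition ideal_exp (e : 'I_m -> nat) : set R[i] :=
  [set x | A x /\ forall i, D (e i) (eps i * x)].

Lemma ideal_expP e : is_ideal n (ideal_exp e).
Proof.
split=> [x []//||x y [Ax Dx] [Ay Dy]|a x Aa [Ax Dx]].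
- by split=> [|i]; rewrite ?mulr0 ?mul0r; exact: Zxi0.
- by split=> [|i]; [exact: ZxiD|rewrite mulrDr; exact: dvd_piD].
- by split=> [|i]; [exact: ZxiM|rewrite mulrCA; exact: dvd_piMl].
Qed.

Lemma eps_eps i j k x : A x -> i != j -> D N (eps i * (pi ^+ k * eps j * x)).
Proof.
move=> Ax ij; rewrite [pi ^+ k * _]mulrC !mulrA.
by apply: dvd_piMr => //; apply: dvd_piMr => //; exact: epsM.
Qed.

Lemma mem_ideal_exp e i k c : (forall j, e j <= N)%N -> A c ->
  (e i <= k)%N -> ideal_exp e (pi ^+ k * eps i * c).
Proof.
move=> eN Ac eik; split=> [|j]; first by apply: ZxiM => //; exact: ZxiM.
have [->|ji] := eqVneq j i; last exact: dvd_pi_le (eN j) (eps_eps _ _ ji).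
apply: dvd_piMl => //; apply: dvd_piMr => //; apply: dvd_piMr => //.
by apply: (dvd_pi_le eik); rewrite divff //; exact: Zxi1.
Qed.

(** Multiplying the quotient by [eps j] gives a multiple of [pi ^+ (N - k)], hence of [pi], while
    [eps j] has residue 1 at [j]. *)
Lemma res_component i k x j : A x -> (k < N)%N -> D k (eps i * x) -> j != i ->
  phi j (eps i * x / pi ^+ k) = 0.
Proof.
move=> Ax kN Dx ji; set y := _ / _.
have yE : pi ^+ k * y = eps i * x by rewrite mulrC /y divfK.
have : D N (pi ^+ k * (eps j * y)).
  by rewrite mulrCA yE mulrA; apply: dvd_piMr => //; exact: epsM.
rewrite -(subnKC (ltnW kN)) dvd_pi_piM => /(@dvd_pi_le 1);
  rewrite subn_gt0 => /(_ kN).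
by move=> /(dvd_pi1_res j); rewrite (resM rs) // phieps eqxx mul1r.
Qed.

(** Induction on the sum of the exponents: lowering a positive [e i] by one enlarges the ideal, and
    the quotient is [F] by the leading coefficient [psi] at the prime [i]. *)
Lemma ideal_exp_index e : (forall j, e j <= N)%N ->
  exists2 T : finType, has_index n (ideal_exp e) T &
    #|T| = (#|F| ^ (\sum_i e i))%N.
Proof.
have [s] := ubnP (\sum_i e i); elim: s e => // s IH e es eN.
have [e0|[i ei]] : (forall i, e i = 0)%N \/ exists i, (0 < e i)%N.
  have [/existsP|/existsPn h] := boolP [exists i, (0 < e i)%N]; first by right.
  by left=> i; have := h i; rewrite lt0n negbK => /eqP.
  exists unit; last by rewrite card_unit big1.
  exists (fun=> tt); split=> [[]|x y Ax Ay]; first by exists 0 => //; exact: Zxi0.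
  split=> // _; split=> [|i]; first exact: ZxiB.
  by rewrite e0 dvd_pi0; apply: ZxiM => //; exact: ZxiB.
pose e' j := (e j - (j == i))%N.
have ee' : (\sum_j e j = (\sum_j e' j).+1)%N.
  rewrite (bigD1 i) // [in RHS](bigD1 i) //= /e' eqxx -addSn; congr addn;
    first by lia.
  by apply: eq_bigr => j /negPf->; rewrite subn0.
have e'N j : (e' j <= N)%N by apply: leq_trans (eN j); exact: leq_subr.
have [|T hT cT] := IH e' _ e'N; first by rewrite -ltnS -ee'.
exists (T * F)%type; last by rewrite card_prod cT ee' expnSr.
have e'i : (e' i).+1 = e i by rewrite /e' eqxx; lia.
have e'iN : (e' i < N)%N by rewrite e'i.
pose psi x := phi i (eps i * x / pi ^+ e' i).
apply: (index_step (ideal_expP e') (psi := psi) hT).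
- move=> x y [_ Dx] [_ Dy]; rewrite /psi mulrDr mulrDl.
  by rewrite (resD rs).
- move=> c; have [u Au phiu] := res_surj rs (fun=> c).
  exists (pi ^+ e' i * eps i * u); first exact: mem_ideal_exp.
  rewrite /psi -[_ * _ * u]mulrA mulrCA [pi ^+ _ * _]mulrC mulfK // !(resM rs)
    ?phieps ?eqxx ?mul1r //.
  by apply: ZxiM.
- move=> x; split=> [[Ax Dx]|[[Ax Dx] psi0]].
    split.
      by split=> // j; apply: dvd_pi_le (Dx j); exact: leq_subr.
    by apply: dvd_pi1_res; rewrite dvd_pi_div e'i.
  split=> // j; have [->|ji] := eqVneq j i; last first.
    by have := Dx j; rewrite /e' (negPf ji) subn0.
  rewrite -e'i -dvd_pi_div; apply/dvd_pi1 => // k.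
  have [->//|ki] := eqVneq k i.
  exact: res_component.
Qed.

Lemma ideal_exp_norm e : (forall j, e j <= N)%N ->
  has_norm n (ideal_exp e) (#|F| ^ (\sum_i e i)).
Proof.
by move=> /ideal_exp_index[T hT <-]; apply: has_norm_index => //;
  exact: ideal_expP.
Qed.

(** This recovers [e i] from the ideal. If [k < e i], membership would make [pi] divide
    [eps i * eps i], whose residue at [i] is 1. *)
Lemma ideal_exp_pi e i k : (forall j, e j <= N)%N -> (k <= N)%N ->
  ideal_exp e (pi ^+ k * eps i) <-> (e i <= k)%N.
Proof.
move=> eN kN; split=> [[_ /(_ i)]|eik]; last first.
  by rewrite -[_ * _]mulr1; apply: mem_ideal_exp => //; exact: Zxi1.
rewrite leqNgt mulrCA => Dk; apply/negP => kei; move: Dk.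
rewrite -(subnKC (ltnW kei)) dvd_pi_piM => /(@dvd_pi_le 1);
  rewrite subn_gt0 => /(_ kei).
move=> /(dvd_pi1_res i); rewrite (resM rs) // phieps eqxx mulr1 => /eqP.
by rewrite oner_eq0.
Qed.

Lemma ideal_exp_inj e e' : (forall j, e j <= N)%N -> (forall j, e' j <= N)%N ->
  ideal_exp e = ideal_exp e' -> e =1 e'.
Proof.
move=> eN e'N ee' i; apply/eqP; rewrite eqn_leq.
apply/andP; split; apply/ideal_exp_pi => //.
  by rewrite ee'; apply/ideal_exp_pi.
by rewrite -ee'; apply/ideal_exp_pi.
Qed.

(** Since [I] contains all multiples of [pi ^+ N], membership in [I] may be tested modulo [pi ^+ N].
    The exponent [e i] is the least [k] with [pi ^+ k * eps i] in [I]. *)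
Lemma ideal_is_exp I : is_ideal n I -> I (pi ^+ N) ->
  exists2 e, (forall j, e j <= N)%N & I = ideal_exp e.
Proof.
move=> idI IN.
have DI x : D N x -> I x.
  by move=> Dx; rewrite -[x](divfK (pik N)); apply: (idealM idI).
have Iex i : exists k, `[< I (pi ^+ k * eps i) >].
  by exists N; apply/asboolP; rewrite mulrC; apply: (idealM idI).
pose e i := ex_minn (Iex i).
have eI i : I (pi ^+ e i * eps i) by rewrite /e; case: ex_minnP => k /asboolP.
have emin i k : I (pi ^+ k * eps i) -> (e i <= k)%N.
  by rewrite /e; case: ex_minnP => k' _ h /asboolP; exact: h.
have eN j : (e j <= N)%N.
  by apply: emin; rewrite mulrC; apply: (idealM idI).
exists e => //; apply/seteqP; split=> [x Ix|x [Ax Dx]]; last first.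
  have epsx i : I (eps i * x).
    (* The first summand is 0 modulo [pi ^+ N], the second a multiple of the generator
       [pi ^+ e i * eps i]. *)
    have -> : eps i * x = (eps i - eps i ^+ 2) * x +
        (eps i * x / pi ^+ e i) * (pi ^+ e i * eps i).
      by rewrite mulrA divfK //; ring.
    apply: (idealD idI) => //; last exact: (idealM idI).
    apply: DI; apply: dvd_piMr => //.
    have -> : eps i - eps i ^+ 2 = eps i * (1 - \sum_j eps j) +
        \sum_(j | j != i) eps i * eps j.
      by rewrite (bigD1 i) //= -mulr_sumr; ring.
    apply: dvd_piD; first exact: dvd_piMl.
    by rewrite mulr_suml; apply: (big_ind A (Zxi0 _ _) (@ZxiD _ _)) => j ji;
      apply: epsM; rewrite eq_sym.
  have -> : x = (1 - \sum_i eps i) * x + \sum_i eps i * x.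
    by rewrite -mulr_suml; ring.
  apply: (idealD idI) => //; first by apply: DI; exact: dvd_piMr.
  by apply: (big_ind I (ideal0 idI) (idealD idI)).
have Ax := ideal_sub idI Ix; split=> // i; apply: contrapT => nDe.
(* the largest [k] with [eps i * x] in [pi ^+ k A] is smaller than [e i], hence
   [eps i * x / pi ^+ k] is a unit at the prime [i] *)
have [k [ke Dk nDk]] : exists k,
    [/\ (k < e i)%N, D k (eps i * x) & ~ D k.+1 (eps i * x)].
  apply: contrapT => /forallNP h; apply: nDe.
  have : (e i <= e i)%N by []; elim: {1 3}(e i) => [_|k IH ke].
    by rewrite dvd_pi0; exact: ZxiM.
  by apply: contrapT => nD; apply: (h k); split=> //; exact: IH (ltnW ke).
have kN : (k < N)%N by exact: leq_trans ke (eN i).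
set y := _ / _ in Dk.
have yE : eps i * x = pi ^+ k * y by rewrite [RHS]mulrC /y divfK.
have phiyj j : j != i -> phi j y = 0 by exact: res_component.
have phiy : phi i y != 0.
  apply/eqP => phiy; apply: nDk; rewrite -dvd_pi_div.
  by apply/dvd_pi1 => // j; have [->//|/phiyj] := eqVneq j i.
(* With this [z], the product [y * z] has the residues of [eps i], so its [p ^ N]-th power is
   [eps i] modulo [pi ^+ N]. *)
have [z Az phiz] := res_surj rs (fun j => if j == i then (phi i y)^-1 else 0).
have Ayz : A (y * z) by exact: ZxiM.
have : I (pi ^+ k * eps i); last by move=> /emin; rewrite leqNgt ke.
rewrite -(subrK ((y * z) ^+ (p ^ N)) (eps i)) mulrDr; apply: (idealD idI) => //.
  apply: DI; apply: dvd_piMl => //; apply: eps_congr => // j.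
  rewrite (resM rs) // phiz; case: eqP => [->|/eqP/phiyj->];
    last by rewrite mul0r.
  by rewrite divff.
(* One of the factors [y] absorbs [pi ^+ k] and becomes [eps i * x], a multiple of an element of
   [I]. *)
have -> : pi ^+ k * (y * z) ^+ (p ^ N) =
    y ^+ (p ^ N).-1 * z ^+ (p ^ N) * eps i * x.
  have : (0 < p ^ N)%N by rewrite expn_gt0 ltnW.
  by case: (p ^ N)%N => // M _; rewrite -[RHS]mulrA yE exprMn exprS; ring.
by rewrite -mulrA; apply: (idealM idI); [apply: ZxiM;
  exact: ZxiX|apply: (idealM idI)].
Qed.

End Idempotents.

Definition bounded_exps (j l N : nat) : set ('I_m -> nat) :=
  [set e | (forall i, e i <= N)%N /\ (j = l * \sum_i e i)%N].

Lemma ideals_of_norm_exp (j l : nat) : prime p -> #|F| = (p ^ l)%N ->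
  exists N eps, (j <= N)%N /\ {in bounded_exps j l N &, injective (ideal_exp eps)} /\
  ideals_of_norm R n (p ^ j) = ideal_exp eps @` bounded_exps j l N.
Proof.
(* As p divides [pi ^+ e], [pi ^+ (e * j)] is a multiple of p^j, which lies in every ideal of norm
   p^j; the summand [j.+1] ensures [j <= N]. *)
move=> pp cF; have [e Ae] := res_exp rs; pose N := (e * j + j.+1)%N.
have [eps [Aeps phieps epsM eps_sum eps_congr]] := idempotents_exist N.
exists N, eps; split; first by rewrite /N; lia.
split=> [f g|].
  rewrite !inE => -[fN _] [gN _] fg; apply: funext.
  exact: (ideal_exp_inj Aeps phieps epsM).
have pexp_inj a b : (p ^ a = p ^ b -> a = b)%N.
  by move=> /eqP; rewrite eqn_exp2l ?prime_gt1 // => /eqP.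
apply/seteqP; split=> [I [idI nI]|_ [f [fN jE] <-]]; last first.
  split; first exact: ideal_expP.
  by rewrite jE expnM -cF; exact: (ideal_exp_norm Aeps phieps epsM fN).
have Ip : I (p ^ j)%:R.
  rewrite -[(p ^ j)%N]card_ord; apply: (index_in_ideal idI).
  by apply: index_has_norm => //; rewrite expn_gt0 prime_gt0.
have p0 : p%:R != 0 :> R[i] by rewrite pnatr_eq0 -lt0n prime_gt0.
have IN : I (pi ^+ N).
  have -> : pi ^+ N = pi ^+ j.+1 * (pi ^+ e / p%:R) ^+ j * (p ^ j)%:R.
    by rewrite -mulrA expr_div_n natrX divfK ?expf_neq0 // -exprM -exprD addnC.
  by apply: (idealM idI) => //; apply: ZxiM; [exact: Api|exact: ZxiX].
have [f fN IE] := ideal_is_exp Aeps phieps epsM eps_sum eps_congr idI IN.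
exists f => //; split=> //; apply: pexp_inj; rewrite expnM -cF.
apply/card_eq_II; apply: card_eq_trans (ideal_exp_norm Aeps phieps epsM fN).
by rewrite -IE card_eq_sym.
Qed.

End Local.

Lemma nb_ideals_residue (R : realType) (n p : nat) (pi : R[i])
    (F : finFieldType) (m l : nat) (phi : 'I_m.+1 -> R[i] -> F) (j : nat) :
  prime p -> p \in [pchar F] -> #|F| = (p ^ l)%N -> (0 < l)%N ->
  residue_system n p pi phi ->
  nb_ideals R n (p ^ j) = if (l %| j)%N then 'C(j %/ l + m, m) else 0%N.
Proof.
move=> pp pF cF l0 rs.
have [N [eps [jN [einj normE]]]] :=
  ideals_of_norm_exp rs (prime_gt1 pp) pF j pp cF.
rewrite /nb_ideals normE.
case: ifPn => [/dvdnP[s js]|lj]; last first.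
  suff -> : @bounded_exps m.+1 j l N = set0 by rewrite image_set0 fset_set0
    cardfs0.
  apply/seteqP; split=> // e [_ je]; move: lj.
  by rewrite je dvdn_mulr.
(* Stars and bars: the binomial counts the (m+1)-tuples of sum [s]. Their entries are at most [s],
   and [s <= j <= N], so the bound [N] excludes none of them. *)
rewrite {2}js mulnK // addnC -card_ord_partitions.
pose S := [set t : m.+1.-tuple 'I_s.+1 | (\sum_(i <- t) (i : nat) == s)%N]%SET.
pose h (t : m.+1.-tuple 'I_s.+1) (i : 'I_m.+1) : nat := tnth t i.
have sN : (s <= N)%N by apply: leq_trans jN; rewrite js leq_pmulr.
have hS : @bounded_exps m.+1 j l N = h @` [set` S].
  apply/seteqP; split=> [e [eN je]|_ [t tS <-]].
    have es : (\sum_i e i = s)%N.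
      by apply/eqP; rewrite -(eqn_pmul2l l0) -je js mulnC.
    have le_es i : (e i < s.+1)%N by rewrite ltnS -es (bigD1 i) //= leq_addr.
    exists [tuple Ordinal (le_es i) | i < m.+1].
      by rewrite /= inE big_tuple; apply/eqP; rewrite -[RHS]es;
        apply: eq_bigr => i _; rewrite tnth_mktuple.
    by apply: funext => i; rewrite /h tnth_mktuple.
  split=> [i|]; first by apply: leq_trans sN; rewrite -ltnS; exact: ltn_ord.
  by move: tS; rewrite /= inE big_tuple => /eqP->; rewrite js mulnC.
apply: card_fset_set; apply: card_eq_trans (inj_card_eq einj) _; rewrite hS.
have hinj : {in [set` S] &, injective h}.
  move=> t u _ _ /funeqP tu; apply: eq_from_tnth => i.
  by apply: val_inj; exact: tu.
exact: card_eq_trans (inj_card_eq hinj) (card_II_finset S).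
Qed.

(** * Cyclotomic polynomials over finite fields *)

Lemma map_intr_poly_inj (p q : {poly int}) :
  map_poly (intr : int -> rat) p = map_poly intr q -> p = q.
Proof. by apply: map_inj_poly => //; exact: intr_inj. Qed.

Lemma horner_intr (K L : nzRingType) (f : {rmorphism K -> L}) (q : {poly int})
  (x : K) :
  f (map_poly intr q).[x] = (map_poly intr q).[f x].
Proof.
rewrite -horner_map -map_poly_comp; congr (_ .[_]).
by apply: eq_map_poly => z /=; rewrite rmorph_int.
Qed.

Lemma Cyclotomic_root_unity (K : idomainType) (d : nat) (w : K) : (0 < d)%N ->
  root (map_poly intr 'Phi_d) w -> w ^+ d = 1.
Proof.
move=> d0 rw; have dd : d \in divisors d by rewrite -dvdn_divisors.
have /(congr1 (fun q : {poly int} => (map_poly intr q : {poly K}).[w])) :=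
  prod_Cyclotomic d0.
rewrite (big_rem d) //= rmorphM hornerM (rootP rw) mul0r.
rewrite rmorphB rmorph1 /= map_polyXn !hornerE => /esym/eqP.
by rewrite subr_eq0 => /eqP.
Qed.

(** [w] is a root of some ['Phi_d] with d dividing n; then w^d = 1, so n divides d. *)
Lemma root_Cyclotomic (K : idomainType) (n : nat) (w : K) :
  n.-primitive_root w -> root (map_poly intr 'Phi_n) w.
Proof.
move=> pw; have n0 := prim_order_gt0 pw.
have /(congr1 (fun q : {poly int} => (map_poly intr q : {poly K}).[w])) :=
  prod_Cyclotomic n0.
rewrite rmorph_prod rmorphB rmorph1 /= map_polyXn !hornerE prim_expr_order //
  subrr.
rewrite horner_prod => /eqP; rewrite prodf_seq_eq0 => /hasP[d dn /= rw].
have dn' : (d %| n)%N by rewrite dvdn_divisors.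
have d0 : (0 < d)%N by exact: dvdn_gt0 dn'.
suff -> : n = d by [].
apply/eqP; rewrite eqn_dvd dn' andbT (prim_order_dvd pw).
by rewrite (Cyclotomic_root_unity d0).
Qed.

(* In characteristic p, X^n - 1 = (X^(n/p) - 1)^p when p | n, so [w] is still a
   root after dividing out the [Phi_d] with d | n/p. *)
Lemma root_Cyclotomic_pchar (K : idomainType) (p r t : nat) (w : K) :
  p \in [pchar K] -> r.-primitive_root w ->
  root (map_poly intr 'Phi_(r * p ^ t)) w.
Proof.
move=> pK pw; case: t => [|t]; first by rewrite muln1; exact: root_Cyclotomic.
have p0 : (0 < p)%N by rewrite prime_gt0 // (pcharf_prime pK).
have p1 : (1 < p)%N by rewrite prime_gt1 // (pcharf_prime pK).
have r0 := prim_order_gt0 pw.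
(* The Frobenius map is injective. *)
have Fr s (x : K) : x ^+ (p ^ s) = 1 -> x = 1.
  elim: s => [|s IH]; rewrite ?expr1 // expnSr exprM => xs; apply/IH/eqP.
  rewrite -subr_eq0 -[_ == 0]andTb -p0 -expf_eq0 -(pFrobenius_autE pK).
  by rewrite (pFrobenius_autB_comm _ (mulrC _ _)) pFrobenius_autE xs
    pFrobenius_aut1 subrr.
set n := (r * p ^ t.+1)%N; pose n' := (r * p ^ t)%N.
have n'0 : (0 < n')%N by rewrite muln_gt0 r0 expn_gt0 p0.
have nE : n = (n' * p)%N by rewrite /n expnSr mulnA.
have n0 : (0 < n)%N by rewrite nE muln_gt0 n'0.
pose ev (q : {poly int}) : {poly K} := map_poly intr q.
have evX k : ev ('X^k - 1) = 'X^k - 1 by rewrite /ev rmorphB rmorph1 /=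
  map_polyXn.
pose G := \prod_(d <- divisors n | ~~ (d %| n')%N) 'Phi_d.
have GE : ev G = ('X^n' - 1) ^+ p.-1.
  apply: (@mulfI _ ('X^n' - 1)); first by rewrite monic_neq0 // monicXnsubC.
  rewrite -exprS prednK // -(pFrobenius_autE (etrans (pchar_poly K p) pK)).
  rewrite (pFrobenius_autB_comm _ (mulrC _ _)) pFrobenius_aut1 pFrobenius_autE
    -exprM -nE.
  rewrite -evX -(evX n) -rmorphM -(prod_Cyclotomic n'0) -(prod_Cyclotomic n0) /=.
  rewrite [in RHS](bigID (fun d => d %| n')%N) /=; congr (ev (_ * _)).
  rewrite -[RHS]big_filter; apply: perm_big; apply: uniq_perm;
    rewrite ?filter_uniq ?divisors_uniq //.
  move=> d; rewrite mem_filter -!dvdn_divisors // andb_idr // => dn'.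
  by rewrite nE dvdn_mulr.
have : (ev G).[w] == 0.
  have wn' : w ^+ n' = 1 by rewrite exprM (prim_expr_order pw) expr1n.
  rewrite GE !hornerE wn' subrr expr0n.
  by case: (p) p1 => [|[]].
rewrite /ev rmorph_prod horner_prod -big_filter prodf_seq_eq0 => /hasP[d].
rewrite mem_filter -dvdn_divisors // => /andP[dn' dn] /= rw.
have d0 : (0 < d)%N by exact: dvdn_gt0 dn.
suff -> : n = d by [].
(* Write d = a p^s with p not dividing a. Then w^a = 1, so r divides a. Moreover a divides r, so s
   <= t would make d divide [n']; hence n divides d. *)
have [a pa dE] := pfactor_coprime (pcharf_prime pK) d0.
have := Cyclotomic_root_unity d0 rw; rewrite dE exprM => /Fr/eqP.
rewrite -(prim_order_dvd pw) => ra.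
have pr : coprime p r.
  rewrite prime_coprime ?(pcharf_prime pK) // (dvdn_pcharf pK).
  by rewrite (prim_root_dvd_eq0 pw).
rewrite -dE; apply/eqP; rewrite eqn_dvd; apply/andP; split; last exact: dn.
rewrite [X in (_ %| X)%N]dE; apply: dvdn_mul => //.
rewrite dvdn_Pexp2l // ltnNge; apply/negP => h; move/negP: dn'; apply.
rewrite dE; apply: dvdn_mul; last by rewrite dvdn_Pexp2l.
have : (a %| r * p ^ t.+1)%N by apply: dvdn_trans dn; rewrite dE dvdn_mulr.
by rewrite Gauss_dvdl // coprimeXr // coprime_sym.
Qed.

(** ['Phi_n] is the minimal polynomial of a primitive root [z]. In a factorization one factor
    vanishes at [z], hence is a multiple of ['Phi_n]; comparing degrees, the other is constant. *)
Lemma Cyclotomic_irreducible (n : nat) : (0 < n)%N ->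
  irreducible_poly (map_poly intr 'Phi_n : {poly rat}).
Proof.
move=> n0; have [z pz] := C_prim_root_exists n0.
set P : {poly rat} := map_poly intr _.
have [P' [P'E monP'] P'P] := minCpolyP z.
have PE : P' = P.
  apply: (map_poly_inj (@ratr algC)); rewrite -P'E (minCpoly_cyclotomic pz).
  rewrite -(Cintr_Cyclotomic pz) -map_poly_comp.
  by apply: eq_map_poly => a /=; rewrite ratr_int.
rewrite PE in P'E P'P monP'.
have P0 : P != 0 by exact: monic_neq0.
have sP : (1 < size P)%N by rewrite -(size_map_poly (@ratr algC)) -P'E
  size_minCpoly.
split=> // q sq /dvdpP[c Pqc].
have q0 : q != 0 by apply: contraNneq P0 => q0; rewrite Pqc q0 mulr0.
have c0 : c != 0 by apply: contraNneq P0 => c0; rewrite Pqc c0 mul0r.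
have : root (map_poly ratr P) z by rewrite P'P.
rewrite {1}Pqc rmorphM rootM !P'P => /orP[Pc|Pq]; last first.
  by rewrite /eqp Pq andbT Pqc dvdp_mull.
have : (size (c * q)%R <= size c)%N by rewrite -Pqc dvdp_leq.
have sq0 : (0 < size q)%N by rewrite size_poly_gt0.
have sc0 : (0 < size c)%N by rewrite size_poly_gt0.
rewrite size_mul //; move: sq sq0 sc0.
by case: (size q) => [|[|s]] //= _ _ _; rewrite addnS addnS /= ltnNge leq_addr.
Qed.

Lemma Cyclotomic_div (n : nat) (q : {poly int}) :
  exists h s : {poly int}, q = h * 'Phi_n + s /\ (size s < size 'Phi_n)%N.
Proof.
exists (Pdiv.Ring.rdivp q 'Phi_n), (Pdiv.Ring.rmodp q 'Phi_n); split.
  by rewrite -Pdiv.RingMonic.rdivp_eq // Cyclotomic_monic.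
by rewrite Pdiv.Ring.ltn_rmodpN0 // monic_neq0 // Cyclotomic_monic.
Qed.

(** The remainder of [q] modulo the monic ['Phi_n] vanishes at [x]. If nonzero, it would be coprime
    over Q to the irreducible ['Phi_n], which also vanishes at [x]. *)
Lemma Cyclotomic_dvd (K : numFieldType) (n : nat) (x : K) (q : {poly int}) :
  n.-primitive_root x -> (map_poly intr q).[x] = 0 -> exists h, q = h * 'Phi_n.
Proof.
move=> px qx; have n0 := prim_order_gt0 px.
have [h [s [qE sn]]] := Cyclotomic_div n q.
suff s0 : s = 0 by exists h; rewrite qE s0 addr0.
have rx := root_Cyclotomic px.
have sx : (map_poly intr s).[x] = 0.
  by move: qx; rewrite qE rmorphD rmorphM /= hornerD hornerM (rootP rx) mulr0
    add0r.
apply/eqP; apply/negPn/negP => s0.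
have s0' : map_poly intr s != 0 :> {poly rat}.
  by apply: contraNneq s0 => s0; apply/eqP/map_intr_poly_inj; rewrite s0 rmorph0.
have intrE (u : {poly int}) : map_poly intr u = map_poly ratr (map_poly intr u
  : {poly rat}) :> {poly K}.
  by rewrite -map_poly_comp; apply: eq_map_poly => a /=; rewrite ratr_int.
have : coprimep (map_poly intr 'Phi_n : {poly rat}) (map_poly intr s).
  rewrite (irreducible_poly_coprime _ (Cyclotomic_irreducible n0)).
  apply/negP => /(dvdp_leq s0'); rewrite !size_map_inj_poly ?rmorph0 //;
    try exact: intr_inj.
  by rewrite leqNgt sn.
rewrite -(coprimep_map (@ratr K)) -!intrE => /coprimep_root/(_ rx).
by rewrite sx eqxx.
Qed.

Lemma xi_primitive (R : realType) (n : nat) :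
  (0 < n)%N -> n.-primitive_root (xi R n).
Proof.
move=> n0; have nR : n%:R != 0 :> R by rewrite pnatr_eq0 -lt0n.
have xiX k : xi R n ^+ k = cos (k%:R * (2 * pi / n%:R)) +i* sin (k%:R * (2 * pi
  / n%:R)).
  rewrite -cexpMn -(rmorph_nat (real_complex R)) /cexp /= !mul0r !mulr0 subr0
    addr0.
  by rewrite expR0 mul1r.
apply/andP; split=> //; apply/forallP => i; apply/eqP; rewrite unity_rootE.
have [->|i1n] := eqVneq i.+1 n.
  rewrite xiX mulrC divfK // [2 * _]mulrC mulr_natr cos2pi sin2pi.
  by apply/eqP.
apply/negP => /eqP; rewrite xiX => -[cosi _].
(* If xi_n^k = 1 with 0 < k < n, then cos (2 a) = 1 for a = k pi / n, so sin a = 0, although 0 < a <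
   pi. *)
have : 0 < sin (i.+1%:R * (pi / n%:R) : R).
  apply: sin_gt0_pi; rewrite mulr_gt0 ?ltr0n ?divr_gt0 ?pi_gt0 ?ltr0n //=.
  rewrite mulrCA -[ltRHS]mulr1 ltr_pM2l ?pi_gt0 //.
  by rewrite ltr_pdivrMr ?ltr0n // mul1r ltr_nat ltn_neqAle i1n ltn_ord.
move: cosi; have -> : i.+1%:R * (2 * pi / n%:R) = (i.+1%:R * (pi / n%:R)) *+ 2
  :> R.
  by rewrite -mulr_natr; ring.
by rewrite cos_mulr2n cos2sin2 => h /(exprn_gt0 2); lra.
Qed.

(** * Frobenius orbits of the primitive r-th roots of unity *)

Section Frobenius.
Variables (F : finFieldType) (p r l : nat).
Hypotheses (pF : p \in [pchar F]) (r_gt0 : (0 < r)%N) (pr : coprime p r).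
Hypothesis cF : #|F| = (p ^ l)%N.
Hypotheses (l_gt0 : (0 < l)%N) (pl : p ^ l = 1 %[mod r]).
Hypothesis lmin : forall k, (0 < k)%N -> p ^ k = 1 %[mod r] -> (l <= k)%N.

Let pp : prime p. Proof. exact: pcharf_prime pF. Qed.

(** The p^l - 1 nonzero elements are all roots of X^(p^l - 1) - 1, so one of them is a primitive
    root of that order, and r divides p^l - 1. *)
Lemma prim_root_exists : exists w : F, r.-primitive_root w.
Proof.
have rdvd : (r %| (p ^ l).-1)%N.
  rewrite -subn1 -eqn_mod_dvd ?expn_gt0 ?prime_gt0 //.
  exact/eqP.
have pl1 : (1 < p ^ l)%N by rewrite (ltn_exp2l 0) ?prime_gt1.
have pl0 : (0 < (p ^ l).-1)%N by rewrite -ltnS prednK // ltnW.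
have card1 : #|F| = (p ^ l).-1.+1 by rewrite cF prednK // ltnW.
suff /hasP[z _ pz] : has (p ^ l).-1.-primitive_root (enum (predC1 (0 : F))).
  by exists (z ^+ ((p ^ l).-1 %/ r)); exact: dvdn_prim_root.
apply: cyclic.has_prim_root => //; last 2 first.
- exact: enum_uniq.
- by rewrite -cardE cardC1 card1.
apply/allP => x; rewrite mem_enum /= inE => x0; rewrite unity_rootE.
by rewrite -(inj_eq (mulfI x0)) mulr1 -exprS -card1 expf_card.
Qed.

Definition prim_roots : {set F} := [set w | r.-primitive_root w]%SET.

Lemma card_prim_roots : #|prim_roots| = totient r.
Proof.
have [w pw] := prim_root_exists.
rewrite totient_count_coprime.
have -> : prim_roots = [set w ^+ (k : nat) | k : 'I_r in [set k : 'I_r |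
  coprime r k]%SET]%SET.
  apply/setP => z; rewrite !inE; apply/idP/imsetP => [pz|[k]].
    have [k zk] := prim_rootP pw (prim_expr_order pz).
    exists k => //; rewrite inE coprime_sym -(prim_root_exp_coprime _ pw).
    by rewrite -zk.
  by rewrite inE => kr ->; rewrite (prim_root_exp_coprime _ pw) coprime_sym.
rewrite card_in_imset.
  rewrite cardsE -sum1_card big_mkord big_mkcond; apply: eq_bigr => k _.
  by rewrite (_ : (k \in _) = coprime r k) //; case: (coprime r k).
move=> i j _ _ /eqP; rewrite (eq_prim_root_expr pw) !modn_small // => /eqP.
exact: val_inj.
Qed.

Definition frob (x : F) := x ^+ p.

Lemma iter_frob k x : iter k frob x = x ^+ (p ^ k).
Proof. by elim: k => [|k IH] //=; rewrite IH /frob -exprM expnSr. Qed.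

Lemma frob_inj : injective frob.
Proof.
by move=> x y; rewrite /frob -!(pFrobenius_autE pF); exact: fmorph_inj.
Qed.

Lemma prim_iter_frob w k : r.-primitive_root w ->
  iter k frob w = w <-> p ^ k = 1 %[mod r].
Proof.
move=> pw; rewrite iter_frob -{2}[w]expr1.
by split=> [/eqP|/eqP h]; [|apply/eqP; move: h];
  rewrite (eq_prim_root_expr pw) // => /eqP.
Qed.

(** The orbit closes after [l] steps because p^l = 1 modulo r, and not earlier by minimality of
    [l]. *)
Lemma order_frob w : r.-primitive_root w -> order frob w = l.
Proof.
move=> pw; apply/eqP; rewrite eqn_leq; apply/andP; split; last first.
  apply: lmin; first exact: order_gt0.
  by apply/(prim_iter_frob _ pw); rewrite iter_order //; exact: frob_inj.
have lE := prednK l_gt0.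
have := @order_le_cycle _ frob (traject frob w l) _ w.
rewrite size_traject; apply; last by rewrite -lE trajectS mem_head.
rewrite -lE trajectS /=.
have -> : rcons (traject frob (frob w) l.-1) w = traject frob (frob w) l.
  rewrite -lE trajectSr -iterSr lE; congr rcons.
  by apply/esym/(prim_iter_frob _ pw).
exact: fpath_traject.
Qed.

(** Frobenius permutes the totient r primitive roots in orbits of length [l]; the [w i] are the
    roots of these orbits. *)
Lemma prim_roots_reps : exists m (w : 'I_m -> F),
  [/\ (m * l = totient r)%N, forall i, r.-primitive_root (w i) &
      forall z, r.-primitive_root z -> exists i k, z = w i ^+ (p ^ k)].
Proof.
have closed_W : fclosed frob prim_roots.
  apply: (intro_closed (fconnect_sym frob_inj)) => x y /eqP <-.
  rewrite !inE => px; rewrite /frob (prim_root_exp_coprime _ px) //.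
have order_W : prim_roots \subset order_set frob l.
  by apply/fintype.subsetP => w; rewrite !inE => pw; apply/eqP/order_frob.
have cardW := fcard_order_set frob_inj order_W closed_W.
pose B := [predI froots frob & prim_roots].
have BE : fcard frob prim_roots = #|B| by [].
exists #|B|, (fun i => enum_val i); split.
- by rewrite -BE cardW card_prim_roots.
- by move=> i; have := enum_valP i; rewrite !inE => /andP[_].
move=> z pz; have zB : froot frob z \in B.
  rewrite !inE; apply/andP; split;
    first exact: (roots_root (fconnect_sym frob_inj)).
  have := closed_connect closed_W (connect_root (frel frob) z).
  by rewrite !inE pz => <-.
exists (enum_rank_in zB (froot frob z)).
rewrite enum_rankK_in //.
have : fconnect frob (froot frob z) z.
  by rewrite (fconnect_sym frob_inj) connect_root.
by move=> /iter_findex zE; exists (findex frob (froot frob z) z);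
  rewrite -iter_frob zE.
Qed.
End Frobenius.

(** * The residue maps of Z[xi_n] above p *)

Section ResidueSystem.
Variables (R : realType) (F : finFieldType) (p r t l m : nat) (w : 'I_m -> F).
Hypotheses (pF : p \in [pchar F]) (r_gt0 : (0 < r)%N) (pr : coprime p r).
Hypothesis cF : #|F| = (p ^ l)%N.
Hypotheses (ml : (m * l = totient r)%N) (pw : forall i, r.-primitive_root (w i)).
Hypothesis reps : forall z : F, r.-primitive_root z ->
  exists i k, z = w i ^+ (p ^ k).
Hypothesis cW : #|prim_roots F r| = totient r.
Local Notation n := (r * p ^ t)%N.
Local Notation A := (Zxi R n).
Local Notation X := (xi R n).
Local Notation ev q x := (map_poly intr q).[x].

Let pp : prime p. Proof. exact: pcharf_prime pF. Qed.
Let p_gt0 : (0 < p)%N. Proof. exact: prime_gt0. Qed.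
Let n_gt0 : (0 < n)%N. Proof. by rewrite muln_gt0 r_gt0 expn_gt0 p_gt0. Qed.
Let pX : n.-primitive_root X. Proof. exact: xi_primitive. Qed.

Lemma intr_pchar (z : int) : z%:~R = 0 :> F -> exists a : int, z = a * p%:Z.
Proof.
case: z => k h; last first.
  have : (p %| k.+1)%N.
    by rewrite (dvdn_pcharf pF) -oppr_eq0 -[X in X == _]/((Negz k)%:~R) h.
  by move=> /dvdnP[a ka]; exists (- a%:Z); rewrite NegzE ka mulNr PoszM.
have : (p %| k)%N by rewrite (dvdn_pcharf pF) -[X in X == _]/((Posz k)%:~R) h.
by move=> /dvdnP[a ->]; exists a%:Z; rewrite PoszM.
Qed.

Lemma evD (K : nzRingType) (q1 q2 : {poly int}) (x : K) :
  ev (q1 + q2) x = ev q1 x + ev q2 x.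
Proof. by rewrite rmorphD hornerD. Qed.

Lemma evM (K : comNzRingType) (q1 q2 : {poly int}) (x : K) :
  ev (q1 * q2) x = ev q1 x * ev q2 x.
Proof. by rewrite rmorphM hornerM. Qed.

Lemma Zxi_ev q x : A x -> A (ev q x).
Proof.
move=> Ax; rewrite horner_coef; apply: Zxi_sum => i; rewrite coef_map.
by apply: ZxiM; [exact: Zxi_int|exact: ZxiX].
Qed.

Lemma ev_pdiv (q : {poly int}) (x : R[i]) :
  A x -> map_poly intr q = 0 :> {poly F} -> A (ev q x / p%:R).
Proof.
move=> Ax q0; rewrite horner_coef mulr_suml; apply: Zxi_sum => i.
rewrite coef_map /= mulrAC; apply: ZxiM; last exact: ZxiX.
have /intr_pchar[a ->] : (q`_i)%:~R = 0 :> F by rewrite -coef_map q0 coef0.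
rewrite intrM mulfK; first exact: Zxi_int.
by rewrite -[_%:~R]/(p%:R) pnatr_eq0 -lt0n.
Qed.

(** An element q(xi_n) goes to q(w i), with some [q] chosen by [xget]; [residueE] shows independence
    of the choice. *)
Definition residue (i : 'I_m) (x : R[i]) : F :=
  ev (xget 0 [set q : {poly int} | ev q X = x]) (w i).

(** Two choices of [q] differ by a multiple of ['Phi_n], which vanishes at [w i] in characteristic p
    although [w i] only has order r. *)
Lemma residueE i (q : {poly int}) : residue i (ev q X) = ev q (w i).
Proof.
rewrite /residue; set q' := xget _ _.
have : ev q' X = ev q X by exact: (xgetPex 0 (ex_intro [set q' | ev q' X = ev q
  X] q erefl)).
move=> /eqP; rewrite -subr_eq0 -hornerN -hornerD -rmorphB /= => /eqP.
move=> /(Cyclotomic_dvd pX)[h qE].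
have -> : q' = h * 'Phi_n + q by rewrite -qE subrK.
rewrite evD evM (rootP (root_Cyclotomic_pchar t pF (pw i))).
by rewrite mulr0 add0r.
Qed.

Lemma ev_frob (q : {poly int}) (z : F) k :
  ev q (z ^+ (p ^ k)) = ev q z ^+ (p ^ k).
Proof.
elim: k => [|k IH]; first by rewrite !expr1.
rewrite expnSr !exprM -IH -!(pFrobenius_autE pF).
by rewrite -(horner_intr (pFrobenius_aut pF)).
Qed.

(** Evaluation commutes with Frobenius, so [q] modulo p vanishes at all totient r primitive roots,
    more than its degree allows. *)
Lemma small_poly_eq0 (q : {poly int}) : (size q <= totient r)%N ->
  (forall i, ev q (w i) = 0) -> map_poly intr q = 0 :> {poly F}.
Proof.
move=> sq qw; apply/eqP/negPn/negP => q0.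
have := max_poly_roots (rs := enum (prim_roots F r)) q0.
rewrite -cardE cW enum_uniq => h.
have : (totient r < size (map_poly intr q : {poly F}))%N.
  apply: h => //; apply/allP => z; rewrite mem_enum inE => /reps[i [k ->]].
  by rewrite rootE ev_frob qw expr0n expn_eq0 -leqn0 leqNgt p_gt0.
by rewrite ltnNge (leq_trans (size_poly _ _)).
Qed.

(* By [small_poly_eq0], the polynomials of degree < totient r with coefficients
   in [0, p) have distinct images in F^m; both sides have p ^ totient r
   elements. *)
Lemma residue_surj (c : 'I_m -> F) :
  exists q : {poly int}, forall i, ev q (w i) = c i.
Proof.
pose q (v : {ffun 'I_(totient r) -> 'I_p}) : {poly int} :=
  rVpoly (\row_k (v k)%:Z).
pose g v := [ffun i => ev (q v) (w i)].
have ginj : injective g.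
  move=> u v guv; apply/ffunP => k; apply: val_inj => /=.
  have : map_poly intr (q u - q v) = 0 :> {poly F}.
    apply: small_poly_eq0 => [|i].
      by rewrite /q -linearB /=; exact: size_poly.
    by have /ffunP/(_ i) := guv; rewrite !ffunE rmorphB hornerD hornerN => ->;
      rewrite subrr.
  move=> /(congr1 (fun q : {poly F} => q`_k));
    rewrite coef_map coefB !coef_rVpoly_ord !mxE coef0.
  rewrite /= intrB => /eqP; rewrite subr_eq0 -!pmulrn.
  wlog uv : u v {guv} / (u k <= v k)%N.
    by move=> W; case/orP: (leq_total (u k) (v k)) => h e;
      [apply: W|apply/esym/W; rewrite // eq_sym].
  rewrite eq_sym -subr_eq0 -natrB // -(dvdn_pcharf pF) => d.
  apply/eqP; rewrite eqn_leq uv /= -subn_eq0; apply/negPn/negP;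
    rewrite -lt0n => d0.
  have := dvdn_leq d0 d; rewrite leqNgt.
  by rewrite (leq_ltn_trans (leq_subr _ _)) // ltn_ord.
have [|v gv] := codomP (inj_card_onto ginj _ [ffun i => c i]).
  by rewrite !card_ffun !card_ord cF -expnM mulnC ml.
by exists (q v) => i; have /ffunP/(_ i) := gv; rewrite !ffunE.
Qed.

(** For t > 0, [X ^+ r] is a primitive p^t-th root of unity, and 1 minus it generates the prime
    above p in Z[xi_(p^t)]. For t = 0, p is unramified. *)
Definition uniformizer : R[i] := if t == 0%N then p%:R else 1 - X ^+ r.
Local Notation pi := uniformizer.

Let pR : p%:R != 0 :> R[i]. Proof. by rewrite pnatr_eq0 -lt0n. Qed.

Lemma uniformizer_neq0 : pi != 0.
Proof.
rewrite /uniformizer; case: ifPn => // t0;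
  rewrite subr_eq0 eq_sym -(prim_order_dvd pX).
apply/negP => /(dvdn_leq r_gt0); rewrite leqNgt ltn_Pmulr //.
by rewrite (ltn_exp2l 0) ?prime_gt1 // lt0n.
Qed.

Lemma uniformizer_in : A pi.
Proof.
rewrite /uniformizer; case: ifP => _; first exact: Zxi_int p%:Z.
by apply: ZxiB; [exact: Zxi1|apply: ZxiX; exact: Zxi_xi].
Qed.

Lemma uniformizer_residue i : residue i pi = 0.
Proof.
rewrite /uniformizer; case: ifP => _.
  have -> : p%:R = ev (p%:R : {poly int}) X :> R[i].
    by rewrite rmorph_nat -polyC_natr hornerC.
  by rewrite residueE rmorph_nat -polyC_natr hornerC (pcharf0 pF).
have evX1 (K : comNzRingType) (x : K) : ev (1 - 'X^r) x = 1 - x ^+ r.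
  by rewrite rmorphB rmorph1 /= map_polyXn !hornerE.
by rewrite -evX1 residueE evX1 (prim_expr_order (pw i)) subrr.
Qed.

Lemma uniformizer_subX k : (0 < t)%N -> A ((1 - X ^+ (r * k)) / pi).
Proof.
move=> t0; have piE : pi = 1 - X ^+ r by rewrite /uniformizer gtn_eqF.
rewrite exprM -{1}(expr1n _ k) subrXX -piE mulrAC divff ?uniformizer_neq0 //
  mul1r.
apply: Zxi_sum => i; rewrite expr1n mul1r; apply: ZxiX; apply: ZxiX.
exact: Zxi_xi.
Qed.

(** For t > 0, [z] is a nontrivial p-th root of unity, so its powers sum to 0 and p is the sum of
    the [1 - z ^+ i], each divisible by [uniformizer]. *)
Lemma uniformizer_dvd_p : A (p%:R / pi).
Proof.
have [t0|t0] := posnP t.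
  by rewrite /uniformizer t0 divff //; exact: Zxi1.
pose z := X ^+ (r * p ^ t.-1).
have z1 : z != 1.
  rewrite -(prim_order_dvd pX); apply/negP => h; have := dvdn_leq _ h.
  rewrite muln_gt0 r_gt0 expn_gt0 p_gt0 => /(_ isT).
  by rewrite leqNgt ltn_pmul2l // ltn_exp2l ?prime_gt1 // prednK // leqnn.
have zp : z ^+ p = 1.
  by rewrite /z -exprM -mulnA -expnSr prednK // (prim_expr_order pX).
have sz : \sum_(i < p) z ^+ i = 0.
  apply/eqP; have := subrX1 z p; rewrite zp subrr => /esym/eqP.
  by rewrite mulf_eq0 subr_eq0 (negPf z1).
have -> : p%:R = \sum_(i < p) (1 - z ^+ i).
  by rewrite sumrB sz subr0 sumr_const card_ord.
rewrite mulr_suml; apply: Zxi_sum => i; rewrite /z -exprM -mulnA.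
exact: uniformizer_subX.
Qed.

Lemma uniformizer_exp : exists e, A (pi ^+ e / p%:R).
Proof.
have [t0|t0] := posnP t.
  by exists 1%N; rewrite expr1 /uniformizer t0 divff //; exact: Zxi1.
(* Modulo p, (1 - X)^(p^t) = 1 - X^(p^t), and the right side vanishes at xi_n^r. *)
exists (p ^ t)%N; pose q : {poly int} := (1 - 'X) ^+ (p ^ t) - (1 - 'X^(p ^ t)).
have q0 : map_poly intr q = 0 :> {poly F}.
  rewrite !(rmorphB, rmorphXn, rmorph1) /= map_polyX.
  apply/eqP; rewrite subr_eq0; apply/eqP; elim: (t) => [|k IH];
    first by rewrite !expr1.
  rewrite expnSr !exprM IH -!(pFrobenius_autE (etrans (pchar_poly F p) pF)).
  by rewrite (pFrobenius_autB_comm _ (mulrC _ _)) pFrobenius_aut1.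
have AXr : A (X ^+ r) by apply: ZxiX; exact: Zxi_xi.
have := ev_pdiv AXr q0.
rewrite !(rmorphB, rmorphXn, rmorph1) /= map_polyX !hornerE -exprM
  (prim_expr_order pX).
by rewrite subrr subr0 /uniformizer gtn_eqF.
Qed.

(* Modulo [pi], xi_n is congruent to its power [Y], a primitive r-th root of
   unity. *)
Lemma Cyclotomic_uniformizer : A (ev 'Phi_r X / pi).
Proof.
have [t0|t0] := posnP t.
  have pX' : r.-primitive_root X by have := pX; rewrite t0 muln1.
  by rewrite (rootP (root_Cyclotomic pX')) mul0r; exact: Zxi0.
pose N := (p ^ t)%N.
have coN : coprime N r by rewrite coprimeXl.
(* By Euler's theorem, [Y] is [X] times a power of [X ^+ r], hence congruent to [X] modulo
   [uniformizer]. *)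
have [c Nc] : exists c, (N ^ totient r = 1 + r * c)%N.
  have : (r %| N ^ totient r - 1)%N.
    by rewrite -eqn_mod_dvd ?expn_gt0 ?p_gt0 //;
      apply/eqP/cyclic.Euler_exp_totient.
  by move=> /dvdnP[c h]; exists c; rewrite mulnC -h subnKC // !expn_gt0 p_gt0.
pose Y := X ^+ (N ^ totient r).
have pY : r.-primitive_root Y.
  rewrite /Y -(prednK (_ : 0 < totient r)%N) ?totient_gt0 // expnS exprM.
  rewrite prim_root_exp_coprime ?coprimeXl //.
  have := dvdn_prim_root pX (dvdn_mulr (p ^ t) (dvdnn r)).
  by rewrite mulKn.
have YE : Y = X * X ^+ (r * c) by rewrite /Y Nc exprD expr1.
(* Subtract ['Phi_r] at [Y], which is 0, and compare term by term. *)
rewrite -[ev _ X]subr0 -(rootP (root_Cyclotomic pY)) !horner_coef -sumrB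
  mulr_suml.
apply: Zxi_sum => i; rewrite -mulrBr -mulrA; apply: ZxiM.
  by rewrite coef_map; exact: Zxi_int.
rewrite YE [(X * _) ^+ i]exprMn -{1}[X ^+ i]mulr1 -mulrBr -mulrA -exprM -mulnA.
apply: ZxiM; first by apply: ZxiX; exact: Zxi_xi.
exact: uniformizer_subX.
Qed.

Lemma cyclotomic_residue_system : residue_system n p pi residue.
Proof.
have res i q : residue i (ev q X) = ev q (w i) by exact: residueE.
split.
- exact: uniformizer_in.
- exact: uniformizer_neq0.
- exact: uniformizer_dvd_p.
- exact: uniformizer_exp.
- move=> i; have ev1 (K : comNzRingType) (x : K) : ev 1 x = 1.
    by rewrite rmorph1 hornerC.
  by rewrite -(ev1 _ X) res ev1.
- by move=> i _ _ [q1 _ <-] [q2 _ <-]; rewrite -evD !res evD.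
- by move=> i _ _ [q1 _ <-] [q2 _ <-]; rewrite -evM !res evM.
- move=> c; have [q qc] := residue_surj c.
  by exists (ev q X) => [|i]; [exists q|rewrite res].
move=> x Ax; split=> [|Axpi i]; last first.
  have [q1 _ q1E] := Axpi; have [q2 _ q2E] := uniformizer_in.
  rewrite -[x](divfK uniformizer_neq0) -q1E -q2E -evM res evM -!res q2E.
  by rewrite uniformizer_residue mulr0.
(* Divide [q] by ['Phi_r]. The remainder has zero residues and small degree, so its coefficients are
   divisible by p, hence by [uniformizer]; the multiple of ['Phi_r] is handled by
   [Cyclotomic_uniformizer]. *)
case: Ax => q _ <- qw.
have [h [s [qE ss]]] := Cyclotomic_div r q.
have s0 : map_poly intr s = 0 :> {poly F}.
  apply: small_poly_eq0 => [|i].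
    by rewrite -ltnS -size_Cyclotomic.
  have := qw i; rewrite res qE evD evM (rootP (root_Cyclotomic (pw i))).
  by rewrite mulr0 add0r.
rewrite qE evD evM mulrDl -mulrA; apply: ZxiD.
  apply: ZxiM; first by apply: Zxi_ev; exact: Zxi_xi.
  exact: Cyclotomic_uniformizer.
have -> : ev s X / pi = (ev s X / p%:R) * (p%:R / pi) by rewrite mulrA divfK.
apply: ZxiM; last exact: uniformizer_dvd_p.
by apply: ev_pdiv => //; exact: Zxi_xi.
Qed.
End ResidueSystem.

(** * The Euler factor *)

Lemma nb_ideals_cyclotomic (R : realType) (p r t l m j : nat) :
  prime p -> (0 < r)%N -> coprime p r -> (0 < l)%N -> p ^ l = 1 %[mod r] ->
  (forall k, (0 < k)%N -> p ^ k = 1 %[mod r] -> (l <= k)%N) ->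
  (m.+1 * l = totient r)%N ->
  nb_ideals R (r * p ^ t) (p ^ j) =
    if (l %| j)%N then 'C(j %/ l + m, m) else 0%N.
Proof.
move=> pp r0 pr l0 pl lmin ml.
have [F pF cF] := pPrimePowerField pp l0.
have [m' [w [ml' pw reps]]] := prim_roots_reps pF pr cF l0 pl lmin.
have mm' : m' = m.+1.
  by apply/eqP; rewrite -(eqn_pmul2r l0) ml ml'.
rewrite {}mm' in w pw reps {ml'}.
apply: (nb_ideals_residue _ pp pF cF l0).
apply: (cyclotomic_residue_system R t pF r0 pr cF ml pw reps).
exact: (card_prim_roots pF cF l0 pl).
Qed.

(** The nonzero terms sit at the multiples of [l] and form the negative binomial series in z^l,
    where z = p^(-s). *)
Lemma euler_factor_geometric (R : realType) (n p l m : nat) (s : R[i]) :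
  (1 < p)%N -> (0 < l)%N -> 0 < complex.Re s ->
  (forall j, nb_ideals R n (p ^ j) =
     if (l %| j)%N then 'C(j %/ l + m, m) else 0%N) ->
  [/\ cvgn (series (euler_term n p s)),
      euler_factor n p s = 1 / (1 - npow p (- (l%:R * s))) ^+ m.+1 &
      series (binomial_term p l m.+1 s) @ \oo --> euler_factor n p s].
Proof.
move=> p1 l0 s0 nbE; set z := npow p (- s).
have z1 : `|z| < 1 by exact: npow_lt1.
have zl1 : `|z ^+ l| < 1 by rewrite normrX exprn_ilt1 // -lt0n.
have /= lim := @negbin_seriesC R m (z ^+ l) zl1.
have elim : series (euler_term n p s) @ \oo --> ((1 - z ^+ l) ^- m.+1 : (R[i])^o).
  apply: (series_gaps l0 _ _ lim) => j.
    by rewrite /euler_term nbE dvdn_mulr // mulKn // npowMn exprM.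
  by move=> lj; rewrite /euler_term nbE (negPf lj) mul0r.
have efE : euler_factor n p s = (1 - z ^+ l) ^- m.+1.
  by apply: cvg_lim elim; exact: norm_hausdorff.
split; first by apply/cvg_ex; exists ((1 - z ^+ l) ^- m.+1).
  by rewrite efE npowMn div1r.
rewrite efE; have -> : binomial_term p l m.+1 s = negbin m (z ^+ l) :> (nat ->
  (R[i])^o).
  apply: funext => j; rewrite /binomial_term /negbin /z npowN addnS !subn1 /=.
  by rewrite div1r -exprM exprVn.
exact: lim.
Qed.

Lemma modz_exp1 (k : int) (p d l : nat) : (p%:Z = k %[mod d%:Z])%Z ->
  (k ^+ l = 1 %[mod d%:Z])%Z <-> p ^ l = 1 %[mod d].
Proof.
move=> pk; rewrite -modzXm -pk modzXm -[1]/(1%N%:Z) -rmorphXn /= !modz_nat.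
by split=> [[]|->].
Qed.

Lemma is_mult_orderP (k : int) (p d l : nat) : (p%:Z = k %[mod d%:Z])%Z ->
  (0 < l)%N -> p ^ l = 1 %[mod d] ->
  (forall k, (0 < k)%N -> p ^ k = 1 %[mod d] -> (l <= k)%N) ->
  is_mult_order k d l.
Proof.
move=> pk l0 pl lmin; split=> //; first exact/(modz_exp1 _ pk).
by move=> l' l'0 /(modz_exp1 _ pk); exact: lmin.
Qed.

Theorem theorem1 (R : realType) (n : nat) (hn : (1 <= n)%N)
    (p : nat) (hp : prime p) :
  exists l m : nat,
    [/\ (0 < l)%N,
        (0 < m)%N,
        (forall s : R[i], 1 < complex.Re s ->
          [/\ cvgn (series (euler_term n p s)),
              euler_factor n p s = 1 / (1 - npow p (- (l%:R * s))) ^+ m &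
              series (binomial_term p l m s) @ \oo --> euler_factor n p s]) &
        (n \in class_number_one_list ->
          (* (i) *)
          (~~ (p %| n)%N -> forall k : int, (p%:Z = k %[mod n%:Z])%Z ->
             is_mult_order k n l /\
             m%:R = (totient n)%:R / l%:R :> rat) /\
          (* (ii) *)
          ((p %| n)%N -> forall r t : nat,
             n = (r * p ^ t)%N -> (1 <= t)%N -> ~~ (p %| r)%N ->
             [/\ is_mult_order p%:Z r l,
                 m%:R = (totient r)%:R / l%:R :> rat &
                 (r = 1%N -> l = 1%N /\ m = 1%N)]))].
Proof.
have [r pr nE] := pfactor_coprime hp hn.
have r0 : (0 < r)%N by case: (r) nE hn => // ->.
have tr0 : (0 < totient r)%N by rewrite totient_gt0.
(* Euler's theorem provides an exponent; the least one is the order of p modulo r. *)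
have lex : exists l, (0 < l)%N && (p ^ l == 1 %[mod r])%N.
  by exists (totient r); rewrite tr0; apply/eqP/cyclic.Euler_exp_totient.
pose l := ex_minn lex.
have [l0 pl lmin] : [/\ (0 < l)%N, p ^ l = 1 %[mod r] &
    forall k, (0 < k)%N -> p ^ k = 1 %[mod r] -> (l <= k)%N].
  rewrite /l; case: ex_minnP => l' /andP[l'0 /eqP pl'] lmin; split=> // k k0 pk.
  by apply: lmin; rewrite k0; apply/eqP.
(* The number of Frobenius orbits in the field with p^l elements, nonzero because totient r is. *)
have [m ml] : exists m, (m.+1 * l = totient r)%N.
  have [F pF cF] := pPrimePowerField hp l0.
  have [[|m] [_ [ml _ _]]] := prim_roots_reps pF pr cF l0 pl lmin.
    by move: tr0; rewrite -ml mul0n ltnn.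
  by exists m.
have mE : m.+1%:R = (totient r)%:R / l%:R :> rat.
  by rewrite -ml natrM mulfK // pnatr_eq0 -lt0n.
exists l, m.+1; split=> // [s s1|_].
  apply: euler_factor_geometric => //; first exact: prime_gt1.
    exact: lt_trans s1.
  by move=> j; rewrite nE; exact: nb_ideals_cyclotomic.
split=> [pn k pk|_ r' t nE' _ pr'].
  have rn : r = n by rewrite nE lognE hp hn (negPf pn) muln1.
  by rewrite -rn in pk *; split=> //; exact: (is_mult_orderP pk).
(* The exponent [t] is the p-adic valuation of [n], which determines the cofactor. *)
have {r' pr' nE'}-> : r' = r.
  have r'0 : (0 < r')%N by case: (r') pr' => //; rewrite dvdn0.
  have tE : logn p n = t.
    rewrite nE' lognM ?expn_gt0 ?(prime_gt0 hp) //.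
    by rewrite pfactorK // lognE hp r'0 (negPf pr').
  apply/eqP; rewrite -(@eqn_pmul2r (p ^ t)) ?expn_gt0 ?prime_gt0 //.
  by rewrite -nE' {1}nE tE.
split=> // [|r1]; first exact: is_mult_orderP.
have l1 : l = 1%N.
  by apply/eqP; rewrite eqn_leq l0 andbT; apply: lmin; rewrite // r1 !modn1.
by split=> //; move: ml; rewrite l1 r1 muln1.
Qed.
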